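(* For every integer $n\ge 0$, $|\mathfrak D^1_{2n}(2341,2413)|=s_{n+1}$, where $s_m$ is the $m$th little Schröder number.
   Context: A Dumont permutation of the first kind of length $2n$ is a permutation $\pi\in\mathfrak S_{2n}$ such that for every $i=1,\dots,2n$: if $\pi(i)$ is even then $i<2n$ and $\pi(i)>\pi(i+1)$; if $\pi(i)$ is odd then $i=2n$ or $\pi(i)<\pi(i+1)$. $\mathfrak D^1_{2n}$ denotes the set of these ($\mathfrak D^1_0$ consists of the empty permutation). A permutation $\sigma$ contains a pattern $\tau\in\mathfrak S_k$ if some subsequence $(\sigma(i_1),\dots,\sigma(i_k))$, $i_1<\dots<i_k$, is order-isomorphic to $\tau$; otherwise $\sigma$ avoids $\tau$. $\mathfrak D^1_{2n}(T)$ denotes the set of permutations in $\mathfrak D^1_{2n}$ avoiding every pattern in $T$. The little Schröder numbers $s_1,s_2,\dots$ ($1,1,3,11,45,\dots$) are defined by the generating function $\sum_{m\ge 1}s_mx^m=\frac{1+x-\sqrt{1-6x+x^2}}{4}$. *)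

(* Defs.v *)
From mathcomp Require Import all_boot all_order all_algebra all_fingroup.
Set Implicit Arguments. Unset Strict Implicit. Unset Printing Implicit Defensive.
Import GRing.Theory Num.Theory.

(* One-line notation of a permutation p of 'I_m, written with values 1..m:
   the word  [:: p(1); ...; p(m)]  (position i+1 <-> ordinal i, value v+1 <-> ordinal v). *)
Definition word m (p : {perm 'I_m}) : seq nat :=
  [seq (val (p i)).+1 | i <- enum 'I_m].

Definition dumont1_word (w : seq nat) : bool :=
  [forall i : 'I_(size w),
    let v := nth 0 w i in
    if ~~ odd v then (i.+1 < size w) && (nth 0 w i.+1 < v)
    else (i.+1 == size w) || (v < nth 0 w i.+1)].

Definition dumont1 n (p : {perm 'I_(2 * n)}) : bool := dumont1_word (word p).

Definition order_iso (u q : seq nat) : bool :=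
  (size u == size q) &&
  [forall a : 'I_(size q), forall b : 'I_(size q),
     (nth 0 u a < nth 0 u b) == (nth 0 q a < nth 0 q b)].

Definition contains (w q : seq nat) : bool :=
  [exists m : (size w).-tuple bool, order_iso (mask m w) q].

Definition avoids_all (w : seq nat) (T : seq (seq nat)) : bool :=
  all (fun q => ~~ contains w q) T.

Definition Dumont1_avoiding n (T : seq (seq nat)) : {set {perm 'I_(2 * n)}} :=
  [set p | dumont1 p & avoids_all (word p) T].

(* Little Schroder numbers s_0 = 0, s_1, s_2, ... as coefficients of
   S(x) = (1 + x - sqrt(1 - 6x + x^2))/4.  S is the unique power series with
   S(0) = 0 satisfying 2 S^2 - (1+x) S + x = 0; comparing coefficients of x^m:
   s_m = 2 * sum_{j=1}^{m-1} s_j s_{m-j} - s_{m-1} + [m = 1]. *)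
Fixpoint schroder_list (m : nat) : seq int :=
  match m with
  | 0 => [:: 0%R]
  | m'.+1 =>
      let l := schroder_list m' in
      rcons l (2 * (\sum_(1 <= j < m'.+1) l`_j * l`_(m'.+1 - j))
               - l`_m' + (m'.+1 == 1)%:R)%R
  end.

Definition pat2341 : seq nat := [:: 2; 3; 4; 1]%N.
Definition pat2413 : seq nat := [:: 2; 4; 1; 3]%N.

Definition little_schroder (m : nat) : int := (schroder_list m)`_m.

(* Main.v *)
(* Let M = 2n+2 be the maximum of a Dumont word w of length 2n+2. The value M - 1 either is the
   last letter of w or immediately precedes M. In the first case avoiding 2413 forces
   w = l M r (M-1) with l < r, in the second avoiding 2341 forces w = l (M-1) M r with
   l < r and r nonempty. Here l and (after a shift by the even number |l|) r are again
   Dumont words avoiding both patterns, and conversely all such pairs occur. So the counts d satisfy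
   d_(n+1) = 2 * sum_(k <= n) d_k d_(n-k) - d_n, the recurrence of s_(n+1). *)
Require Import Defs.
From mathcomp Require Import all_boot all_order all_algebra all_fingroup.
From mathcomp Require Import zify.

Set Implicit Arguments. Unset Strict Implicit. Unset Printing Implicit Defensive.

(** * The Dumont condition and pattern avoidance on sequences *)

Definition step (a b : nat) : bool := if odd a then a < b else b < a.

(** The default [1] is odd, so the empty word counts as a Dumont word. *)
Definition dumont_seq (w : seq nat) : bool := sorted step w && odd (last 1 w).

Lemma dumont1_wordE w :
  dumont1_word w = dumont_seq w.
Proof.
rewrite /dumont_seq; apply/forallP/andP => [Hw|[/(sortedP 0) Hs Hl] i].
  split.
    apply/(sortedP 0) => i ltiw; rewrite /step.
    have := Hw (Ordinal (ltnW ltiw)); rewrite /= ltiw /=.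
    by case: (odd _) => //= /orP[/eqP Ei|//]; rewrite Ei ltnn in ltiw.
  case: w Hw => [//|x w] Hw.
  have := Hw (Ordinal (ltnSn (size w))).
  rewrite /= ltnn /= (nth_last 0 (x :: w)) /=.
  by case: (odd _).
rewrite /=; case: (ltnP i.+1 (size w)) => [ltiw|lewi].
  by have := Hs _ ltiw; rewrite /step; case: (odd _) => //= ->; rewrite orbT.
have Ei : i.+1 = size w by apply/eqP; rewrite eqn_leq lewi ltn_ord.
have -> : nth 0 w i = last 1 w.
  by case: w i {lewi Hs Hl} Ei => [[]//|x w i /= [->]]; rewrite (last_nth 0).
by rewrite Hl Ei eqxx.
Qed.

Lemma containsP w q :
  reflect (exists2 u, subseq u w & order_iso u q) (contains w q).
Proof.
apply: (iffP existsP) => [[m Hm]|[u /subseqP[m sz_m ->] Hu]].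
  by exists (mask m w) => //; apply: mask_subseq.
by exists (tcast sz_m (in_tuple m)); rewrite val_tcast.
Qed.

(** A chain of three strict inequalities fixes the order type of four letters; the chains list the
    letters of each pattern from smallest to largest. *)
Lemma avoids_allP w :
  reflect (forall a b c d, subseq [:: a; b; c; d] w ->
             ~~ [&& d < a, a < b & b < c] && ~~ [&& c < a, a < d & d < b])
          (avoids_all w [:: pat2341; pat2413]).
Proof.
apply: (iffP idP) => [/and3P[Hn1 Hn2 _] a b c d Hsub|Hw].
  apply/andP; split; apply/negP => /and3P[h1 h2 h3].
    case/containsP: Hn1; exists [:: a; b; c; d] => //=; apply/andP; split=> //.
    by apply/forallP => -[[|[|[|[|//]]]] ?]; apply/forallP => -[[|[|[|[|//]]]] ?] /=; lia.
  case/containsP: Hn2; exists [:: a; b; c; d] => //=; apply/andP; split=> //.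
  by apply/forallP => -[[|[|[|[|//]]]] ?]; apply/forallP => -[[|[|[|[|//]]]] ?] /=; lia.
have iso_lt u q i j : order_iso u q -> i < size q -> j < size q ->
    nth 0 q i < nth 0 q j -> nth 0 u i < nth 0 u j.
  case/andP=> _ /forallP Hf lti ltj.
  by have /forallP/(_ (Ordinal ltj))/eqP/= := Hf (Ordinal lti) => ->.
rewrite /= andbT; apply/andP; split; apply/containsP => -[u Hu Hiso].
  (* Positions 3, 0, 1, 2 carry the values 1, 2, 3, 4 of 2341; below, positions 2, 0, 3, 1 do so for
     2413. *)
  have := iso_lt u _ 3 0 Hiso erefl erefl erefl.
  have := iso_lt u _ 0 1 Hiso erefl erefl erefl.
  have := iso_lt u _ 1 2 Hiso erefl erefl erefl.
  case/andP: Hiso; case: u Hu => [|a [|b [|c [|d []]]]] //= /Hw/andP[/and3P Hn _] _ _ h1 h2 h3.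
  by case: Hn.
have := iso_lt u _ 2 0 Hiso erefl erefl erefl.
have := iso_lt u _ 0 3 Hiso erefl erefl erefl.
have := iso_lt u _ 3 1 Hiso erefl erefl erefl.
case/andP: Hiso; case: u Hu => [|a [|b [|c [|d []]]]] //= /Hw/andP[_ /and3P Hn] _ _ h1 h2 h3.
by case: Hn.
Qed.

Notation avoids w := (avoids_all w [:: pat2341; pat2413]).

(** * Behaviour under shifts, concatenation and added letters *)

Lemma subseq_catP (T : eqType) (u s1 s2 : seq T) :
  subseq u (s1 ++ s2) ->
  exists u1 u2, [/\ u = u1 ++ u2, subseq u1 s1 & subseq u2 s2].
Proof.
case/subseqP=> m sz_m ->; rewrite -[m](cat_take_drop (size s1)) mask_cat.
  by do 2!eexists; split; first reflexivity; apply: mask_subseq.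
by rewrite size_takel // sz_m size_cat leq_addr.
Qed.

Lemma avoids_subseq s w : subseq s w -> avoids w -> avoids s.
Proof.
move=> sub_sw /avoids_allP Hw; apply/avoids_allP=> a b c d Hu.
exact: Hw (subseq_trans Hu sub_sw).
Qed.

Lemma avoids_addn l w : avoids (map (addn l) w) = avoids w.
Proof.
apply/avoids_allP/avoids_allP => Hw a b c d.
  by move/(map_subseq (addn l))/Hw; rewrite !ltn_add2l.
case/subseqP=> m _; rewrite -map_mask.
case E: (mask m w) => [|a' [|b' [|c' [|d' []]]]] //= [-> -> -> ->].
by rewrite !ltn_add2l; apply: Hw; rewrite -E mask_subseq.
Qed.

(* Both patterns are indecomposable for the direct sum of permutations. *)
Lemma avoids_cat (s1 s2 : seq nat) :
  {in s1 & s2, forall a b, a < b} -> avoids s1 -> avoids s2 -> avoids (s1 ++ s2).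
Proof.
move=> lt12 /avoids_allP av1 /avoids_allP av2; apply/avoids_allP=> a b c d.
case/subseq_catP=> u1 [u2 [Eu Hu1 Hu2]].
have lt_u x y : x \in u1 -> y \in u2 -> x < y.
  by move=> xu yu; apply: lt12; [apply: (mem_subseq Hu1) | apply: (mem_subseq Hu2)].
case: u1 Eu Hu1 lt_u => [|x1 [|x2 [|x3 [|x4 u1]]]] /=.
- by move=> Eu _ _; apply: av2; rewrite Eu.
- case=> ? ?; subst x1 u2 => _ lt_u.
  by have := lt_u a c; have := lt_u a d; rewrite !inE !eqxx ?orbT; lia.
- case=> ? ? ?; subst x1 x2 u2 => _ lt_u.
  by have := lt_u a c; have := lt_u a d; rewrite !inE !eqxx ?orbT; lia.
- case=> ? ? ? ?; subst x1 x2 x3 u2 => _ lt_u.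
  by have := lt_u a d; have := lt_u b d; rewrite !inE !eqxx ?orbT; lia.
by case=> -> -> -> ->; case: u1 => //= _ Hu1 _; apply: av1.
Qed.

(** Both patterns begin with their second smallest letter, so an occurrence starting at [x] needs
    two distinct later values above [x]. *)
Lemma avoids_cons x s :
  {in s &, forall y z, x < y -> y < z -> false} -> avoids s -> avoids (x :: s).
Proof.
move=> no_asc /avoids_allP av; apply/avoids_allP=> a b c d /=.
case: eqP => [-> Hs|_]; last exact: av.
have := no_asc b c; have := no_asc d b.
by rewrite !(mem_subseq Hs) ?inE ?eqxx ?orbT //; lia.
Qed.

(** Appending a maximum is a direct sum with a one-letter word. *)
Lemma avoids_rcons x s :
  {in s, forall y, y < x} -> avoids s -> avoids (rcons s x).
Proof.
move=> lt_sx av; rewrite -cats1; apply: avoids_cat => //.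
  by move=> a b /lt_sx lt_ax; rewrite inE => /eqP ->.
by apply: avoids_cons => //; apply/avoids_allP.
Qed.

Lemma step_addn l a b : ~~ odd l -> step (l + a) (l + b) = step a b.
Proof. by rewrite /step oddD !ltn_add2l => /negbTE ->. Qed.

Lemma dumont_addn l w : ~~ odd l -> dumont_seq (map (addn l) w) = dumont_seq w.
Proof.
move=> even_l; rewrite /dumont_seq sorted_map.
rewrite (eq_sorted (e' := step)) => [|a b]; last exact: step_addn.
by case/lastP: w => // w x; rewrite map_rcons !last_rcons oddD (negbTE even_l).
Qed.

(** The junction is an ascent, so it is legal exactly when the last letter of [s1] is odd, which is
    the end condition for [s1] alone. *)
Lemma dumont_cat (s1 s2 : seq nat) :
    {in s1 & s2, forall a b, a < b} -> s2 != [::] ->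
  dumont_seq (s1 ++ s2) = dumont_seq s1 && dumont_seq s2.
Proof.
case: s2 => [//|y s2] lt12 _; case: s1 lt12 => [//|x s1] lt12.
have lt_xy : last x s1 < y by apply: lt12; rewrite ?mem_last ?mem_head.
rewrite /dumont_seq last_cat /= cat_path /= [step _ y]/step lt_xy.
rewrite [y < _]ltnNge (ltnW lt_xy) /=.
by case: (odd (last x s1)); rewrite /= ?andbT ?andbF ?andbA.
Qed.

(** An even letter is never last and is followed by a smaller one, so it cannot be the minimum. *)
Lemma dumont_min_odd s x :
  dumont_seq s -> x \in s -> {in s, forall y, x <= y} -> odd x.
Proof.
case/andP=> ss odd_s /path.splitPr E; case: E ss odd_s => s1 s2.
rewrite last_cat /= => /cat_sorted2[_]; case: s2 => [//|y s2] /= /andP[].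
rewrite /step; case: (odd x) => // lt_yx _ _ /(_ y).
by rewrite leqNgt lt_yx mem_cat !inE eqxx !orbT => /(_ isT).
Qed.

(** * Avoiding Dumont words and their splitting into blocks *)

Definition dumont_words n : seq (seq nat) :=
  [seq w <- permutations (iota 1 (2 * n)) | dumont_seq w && avoids w].

Lemma mem_dumont_words n w :
  (w \in dumont_words n) = [&& dumont_seq w, avoids w & perm_eq w (iota 1 (2 * n))].
Proof. by rewrite mem_filter mem_permutations andbA. Qed.

Lemma mem_iota_perm s m k :
  perm_eq s (iota m k) -> forall x, (x \in s) = (m <= x < m + k).
Proof. by move=> /perm_mem E x; rewrite E mem_iota. Qed.

(** Since [s1] lies below [s2], sorting each block separately sorts the whole; the result is the
    interval itself, cut at [size s1]. *)
Lemma perm_iota_cat (s1 s2 : seq nat) m k :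
    {in s1 & s2, forall a b : nat, a < b} -> perm_eq (s1 ++ s2) (iota m k) ->
  perm_eq s1 (iota m (size s1)) /\ perm_eq s2 (iota (m + size s1) (size s2)).
Proof.
move=> lt12 Es.
have Ek : k = size s1 + size s2 by rewrite -size_cat (perm_size Es) size_iota.
have : sort leq s1 ++ sort leq s2 = iota m k.
  apply: (sorted_eq leq_trans anti_leq); last 1 first.
  - by rewrite (perm_trans _ Es) // perm_cat // perm_sort.
  - rewrite (sorted_pairwise leq_trans) pairwise_cat -!(sorted_pairwise leq_trans).
    rewrite !sort_sorted ?andbT; try exact: leq_total.
    apply/allrelP=> a b; rewrite !mem_sort => a1 b2; exact: ltnW (lt12 _ _ a1 b2).
  exact: iota_sorted.
rewrite Ek iotaD => /eqP; rewrite eqseq_cat ?size_sort ?size_iota //.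
by case/andP=> /eqP <- /eqP <-; rewrite ![perm_eq _ (sort _ _)]perm_sym !perm_sort.
Qed.

(* The minimum of a Dumont word is odd, so the block lying above has to start
   at an odd value. *)
Lemma dumont_split n (l r : seq nat) :
    {in l & r, forall a b : nat, a < b} -> perm_eq (l ++ r) (iota 1 (2 * n)) ->
    dumont_seq l -> avoids l -> dumont_seq r -> avoids r ->
  exists k r', [/\ k <= n, l \in dumont_words k, r' \in dumont_words (n - k)
                 & r = map (addn (2 * k)) r'].
Proof.
move=> lt_lr Elr Dl Al Dr Ar; have [El Er] := perm_iota_cat lt_lr Elr.
have Esz : 2 * n = size l + size r by rewrite -size_cat (perm_size Elr) size_iota.
have even_l : ~~ odd (size l).
  case: (posnP (size r)) => [r0|r_gt0]; first by lia.
  suff : odd (1 + size l) by [].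
  apply: (dumont_min_odd Dr) => [|y]; rewrite (mem_iota_perm Er); lia.
have El2 : size l = 2 * (size l)./2 by lia.
pose r' := map (subn^~ (size l)) r.
have Err' : r = map (addn (size l)) r'.
  rewrite -map_comp -[LHS]map_id; apply/eq_in_map => y /=.
  by rewrite (mem_iota_perm Er) => /andP[lt_ly _]; rewrite subnKC // ltnW.
exists (size l)./2, r'; split; first by lia.
- by rewrite mem_dumont_words Dl Al -El2.
- rewrite mem_dumont_words -(@dumont_addn (size l)) // -(@avoids_addn (size l)) -Err' Dr Ar /=.
  have <- : size r = 2 * (n - (size l)./2) by lia.
  apply: (@perm_map_inj _ _ (addn (size l))); first exact: addnI.
  by rewrite -Err' -iotaDl addnC.
by rewrite -El2.
Qed.

(** * The two gluing maps *)

(** Here [k] stands for half the length of [u.1], so that the shift by [2 * k] puts [u.2] just above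
    [u.1]. *)
Definition glue1 n k (u : seq nat * seq nat) : seq nat :=
  u.1 ++ (2 * n).+2 :: rcons (map (addn (2 * k)) u.2) (2 * n).+1.

Definition glue2 n k (u : seq nat * seq nat) : seq nat :=
  rcons u.1 (2 * n).+1 ++ (2 * n).+2 :: map (addn (2 * k)) u.2.

(** The block [l] splits off below the rest, and [r] below the final odd [x]. The even maximum only
    needs a successor, which [x] supplies even when [r] is empty. *)
Lemma dumont_glue1 (l r : seq nat) x :
    {in l & r, forall a b, a < b} -> {in l ++ r, forall a, a < x} -> odd x ->
  dumont_seq (l ++ x.+1 :: rcons r x) = dumont_seq l && dumont_seq r.
Proof.
move=> lt_lr lt_x odd_x.
have lt_rx : {in r & [:: x], forall a b, a < b}.
  by move=> a b ar; rewrite inE => /eqP ->; apply: lt_x; rewrite mem_cat ar orbT.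
rewrite dumont_cat //; first congr andb.
  have <- : dumont_seq (rcons r x) = dumont_seq r.
    by rewrite -cats1 dumont_cat // [dumont_seq [:: x]]/dumont_seq /= odd_x andbT.
  rewrite /dumont_seq; case E: (rcons r x) => [|y s]; first by case: r {lt_lr lt_x lt_rx} E.
  rewrite /= /step /= odd_x /= ltnS.
  suff -> : y <= x by [].
  have : y \in rcons r x by rewrite E mem_head.
  rewrite mem_rcons inE => /predU1P[->//|yr]; apply: ltnW.
  by apply: lt_rx; rewrite ?inE.
move=> a b al; have lt_ax : a < x by apply: lt_x; rewrite mem_cat al.
rewrite inE mem_rcons inE => /or3P[/eqP ->|/eqP ->|/lt_lr]; [exact: ltnW | by []| exact].
Qed.

(** The even letter [x.+1] cannot end a word, whence the condition [r != [::]]. *)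
Lemma dumont_glue2 (l r : seq nat) x :
    {in l & r, forall a b, a < b} -> {in l ++ r, forall a, a < x} -> odd x ->
  dumont_seq (rcons l x ++ x.+1 :: r) = [&& dumont_seq l, dumont_seq r & r != [::]].
Proof.
move=> lt_lr lt_x odd_x; rewrite cat_rcons dumont_cat //; last first.
  move=> a b al; have lt_ax : a < x by apply: lt_x; rewrite mem_cat al.
  rewrite !inE => /or3P[/eqP ->|/eqP ->|/lt_lr]; [by [] | exact: ltnW | exact].
congr andb; rewrite /dumont_seq /= {1}/step odd_x ltnSn /=.
case: r lt_x {lt_lr} => [|y r] lt_x; first by rewrite /= odd_x.
rewrite /= {1}/step /= odd_x andbT.
suff -> : y < x.+1 by [].
by rewrite ltnS ltnW // lt_x // mem_cat mem_head orbT.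
Qed.

Lemma avoids_glue1 (l r : seq nat) x :
    {in l & r, forall a b, a < b} -> {in l ++ r, forall a, a < x} ->
  avoids l -> avoids r -> avoids (l ++ x.+1 :: rcons r x).
Proof.
move=> lt_lr lt_x Al Ar; have lt_rx : {in r, forall a, a < x}.
  by move=> a ar; apply: lt_x; rewrite mem_cat ar orbT.
apply: avoids_cat => //.
  move=> a b al; have lt_ax : a < x by apply: lt_x; rewrite mem_cat al.
  rewrite inE mem_rcons inE => /or3P[/eqP ->|/eqP ->|/lt_lr]; [exact: ltnW | by []| exact].
apply: avoids_cons; last exact: avoids_rcons.
move=> y z _; rewrite mem_rcons inE => /predU1P[->|/lt_rx]; lia.
Qed.

(** After [x] the only larger letter is [x.+1], and after [x.+1] there is none, so neither can start
    an occurrence; [l] is a direct summand. *)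
Lemma avoids_glue2 (l r : seq nat) x :
    {in l & r, forall a b, a < b} -> {in l ++ r, forall a, a < x} ->
  avoids l -> avoids r -> avoids (rcons l x ++ x.+1 :: r).
Proof.
move=> lt_lr lt_x Al Ar; have lt_rx : {in r, forall a, a < x}.
  by move=> a ar; apply: lt_x; rewrite mem_cat ar orbT.
rewrite cat_rcons; apply: avoids_cat => //.
  move=> a b al; have lt_ax : a < x by apply: lt_x; rewrite mem_cat al.
  rewrite !inE => /or3P[/eqP ->|/eqP ->|/lt_lr]; [by [] | exact: ltnW | exact].
apply: avoids_cons.
  by move=> y z; rewrite !inE => /predU1P[->|/lt_rx ?] /predU1P[->|/lt_rx]; lia.
by apply: avoids_cons => // y z /lt_rx; lia.
Qed.

(** Converse of [dumont_split]: the shift is even, so it keeps parities and comparisons. *)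
Lemma dumont_join n k (l r : seq nat) :
    k <= n -> l \in dumont_words k -> r \in dumont_words (n - k) ->
    let r' := map (addn (2 * k)) r in
  [/\ {in l & r', forall a b, a < b}, perm_eq (l ++ r') (iota 1 (2 * n)),
      dumont_seq r' & avoids r'].
Proof.
rewrite !mem_dumont_words => le_kn /and3P[Dl Al El] /and3P[Dr Ar Er] r'.
rewrite /r' dumont_addn ?avoids_addn; last by lia.
split=> // [a b|].
  rewrite (mem_iota_perm El) => lt_a /mapP[c].
  by rewrite (mem_iota_perm Er) => ? ->; lia.
have -> : 2 * n = 2 * k + 2 * (n - k) by lia.
rewrite iotaD perm_cat // addnC iotaDl.
exact: perm_map.
Qed.

Lemma perm_glue s1 s2 s3 n :
  perm_eq s1 (s2 ++ [:: (2 * n).+1; (2 * n).+2]) -> perm_eq s2 s3 ->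
  perm_eq s3 (iota 1 (2 * n)) = perm_eq s1 (iota 1 (2 * n.+1)).
Proof.
move=> E1 E2; rewrite mulnS -[2 + _]addnC iotaD /= !add1n.
by rewrite (permPl E1) perm_cat2r -(permPl E2).
Qed.

Lemma perm_glue1 (l r : seq nat) n :
  perm_eq (l ++ (2 * n).+2 :: rcons r (2 * n).+1) (iota 1 (2 * n.+1))
    = perm_eq (l ++ r) (iota 1 (2 * n)).
Proof.
apply/esym/perm_glue/perm_refl; apply/seq.permP=> p.
by rewrite -cats1 !count_cat /= ?count_cat /=; lia.
Qed.

Lemma perm_glue2 (l r : seq nat) n :
  perm_eq (rcons l (2 * n).+1 ++ (2 * n).+2 :: r) (iota 1 (2 * n.+1))
    = perm_eq (l ++ r) (iota 1 (2 * n)).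
Proof.
apply/esym/perm_glue/perm_refl; apply/seq.permP=> p.
by rewrite -cats1 !count_cat /= ?count_cat /=; lia.
Qed.

Lemma glue1_dumont n k (l r : seq nat) :
    k <= n -> l \in dumont_words k -> r \in dumont_words (n - k) ->
  glue1 n k (l, r) \in dumont_words n.+1.
Proof.
move=> le_kn wl wr; have [lt_lr Elr Dr Ar] := dumont_join le_kn wl wr.
have lt_x : {in l ++ map (addn (2 * k)) r, forall a, a < (2 * n).+1}.
  by move=> a; rewrite (mem_iota_perm Elr) => /andP[].
move: wl; rewrite !mem_dumont_words => /and3P[Dl Al _].
by rewrite dumont_glue1 ?avoids_glue1 ?perm_glue1 ?Dl ?Dr //=; lia.
Qed.

Lemma glue2_dumont n k (l r : seq nat) :
    k < n -> l \in dumont_words k -> r \in dumont_words (n - k) ->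
  glue2 n k (l, r) \in dumont_words n.+1.
Proof.
move=> lt_kn wl wr; have [lt_lr Elr Dr Ar] := dumont_join (ltnW lt_kn) wl wr.
have lt_x : {in l ++ map (addn (2 * k)) r, forall a, a < (2 * n).+1}.
  by move=> a; rewrite (mem_iota_perm Elr) => /andP[].
have r_n0 : map (addn (2 * k)) r != [::].
  move: wr; rewrite mem_dumont_words => /and3P[_ _ /perm_size].
  by rewrite size_iota -size_eq0 size_map => ->; lia.
move: wl; rewrite !mem_dumont_words => /and3P[Dl Al _].
by rewrite dumont_glue2 ?avoids_glue2 ?perm_glue2 ?Dl ?Dr ?r_n0 //=; lia.
Qed.

(** * Every avoiding Dumont word arises by gluing *)

Lemma dumont_unglue n w : w \in dumont_words n.+1 ->
  exists k u, [/\ u.1 \in dumont_words k, u.2 \in dumont_words (n - k)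
    & k <= n /\ w = glue1 n k u \/ k < n /\ w = glue2 n k u].
Proof.
rewrite mem_dumont_words => /and3P[Dw /[dup] Aw /avoids_allP av Ew].
have in_w := mem_iota_perm Ew.
have Uw : uniq w by rewrite (perm_uniq Ew) iota_uniq.
have: (2 * n).+2 \in w by rewrite in_w; lia.
set x := (2 * n).+1; have odd_x : odd x by rewrite /x; lia.
have x_w : x \in w by rewrite in_w /x; lia.
move=> Mw; case/path.splitPr: w / Mw => [l r] in Dw Aw av Ew in_w Uw x_w *.
(* A letter following the odd [x] must exceed it, and only [x.+1] is available. *)
have succ_x s1 y s2 : l ++ x.+1 :: r = s1 ++ x :: y :: s2 -> y = x.+1.
  move=> Es; have : y \in l ++ x.+1 :: r by rewrite Es mem_cat !inE eqxx !orbT.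
  case/andP: Dw => + _; rewrite in_w Es => /cat_sorted2[_ /= /andP[+ _]].
  by rewrite /step odd_x /x; lia.
have sub_l : subseq l (l ++ x.+1 :: r) by apply: prefix_subseq.
have sub_r : subseq r (l ++ x.+1 :: r).
  exact: subseq_trans (subseq_cons _ _) (suffix_subseq _ _).
have [NMl NMr] : x.+1 \notin l /\ x.+1 \notin r.
  by move: Uw; rewrite uniq_catC /= mem_cat negb_or => /andP[/andP[-> ->]].
(* Either [x] precedes the maximum, which leads to [glue2], or it follows it, which leads to
   [glue1]. *)
move: x_w {in_w Uw}; rewrite mem_cat inE => /or3P[xl|/eqP|xr]; [|lia|].
  case/path.splitPr: l / xl => [l1 l2] in succ_x sub_l sub_r NMl Dw Aw av Ew *.
  (* A letter after [x] within the left part would be a second copy of [x.+1]; so [x] stands right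
     before the maximum. *)
  case: l2 => [|y l2] in succ_x sub_l sub_r NMl Dw Aw av Ew *; last first.
    have Ey := succ_x l1 y (l2 ++ x.+1 :: r); case/negP: NMl.
    by rewrite -Ey -?catA // mem_cat !inE eqxx !orbT.
  rewrite cats1 in sub_l sub_r Dw Aw av Ew *.
  move: Ew; rewrite perm_glue2 => Elr.
  have lt_x : {in l1 ++ r, forall a, a < x}.
    by move=> a; rewrite (mem_iota_perm Elr) => /andP[].
  have lt_lr : {in l1 & r, forall a b, a < b}.
    move=> a b al br.
    have neq_ab : a != b.
      apply/eqP=> Eab; have := iota_uniq 1 (2 * n); rewrite -(perm_uniq Elr).
      by rewrite cat_uniq => /and3P[_ /hasPn/(_ b br)]; rewrite -Eab /= al.
    have lt_ax : a < x by apply: lt_x; rewrite mem_cat al.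
    (* If [b < a], then [a], [x], [x.+1], [b] would form 2341. *)
    have := av a x x.+1 b; rewrite cat_rcons lt_ax ltnSn !andbT.
    have -> : subseq [:: a; x; x.+1; b] (l1 ++ x :: x.+1 :: r).
      by apply: (@cat_subseq _ [:: a]); rewrite ?sub1seq //= !eqxx sub1seq.
    by move=> /(_ isT)/andP[]; lia.
  move: Dw; rewrite dumont_glue2 // => /and3P[Dl Dr r_n0].
  have [||k [r' [le_kn wl wr Er]]] := dumont_split lt_lr Elr Dl _ Dr _.
  - by apply: avoids_subseq Aw; apply: subseq_trans sub_l; apply: subseq_rcons.
  - exact: avoids_subseq Aw.
  exists k, (l1, r'); split=> //; right; split; last by rewrite /glue2 Er.
  (* For [k = n] the word [r'] would be empty, against [r_n0]. *)
  rewrite ltn_neqAle le_kn andbT; apply: contraNneq r_n0 => Ek.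
  move: wr; rewrite Er Ek subnn mem_dumont_words => /and3P[_ _ /perm_size/eqP].
  by rewrite size_iota muln0 size_eq0 => /eqP ->.
case/path.splitPr: r / xr => [r1 r2] in succ_x sub_l sub_r NMr Dw Aw av Ew *.
(* Again [x] can have no successor here, so it is the last letter. *)
case: r2 => [|y r2] in succ_x sub_l sub_r NMr Dw Aw av Ew *; last first.
  have Ey := succ_x (l ++ x.+1 :: r1) y r2; case/negP: NMr.
  by rewrite -Ey -?catA // mem_cat !inE eqxx !orbT.
rewrite cats1 in sub_l sub_r Dw Aw av Ew *.
move: Ew; rewrite perm_glue1 => Elr.
have lt_x : {in l ++ r1, forall a, a < x}.
  by move=> a; rewrite (mem_iota_perm Elr) => /andP[].
have lt_lr : {in l & r1, forall a b, a < b}.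
  move=> a b al br.
  have neq_ab : a != b.
    apply/eqP=> Eab; have := iota_uniq 1 (2 * n); rewrite -(perm_uniq Elr).
    by rewrite cat_uniq => /and3P[_ /hasPn/(_ b br)]; rewrite -Eab /= al.
  have lt_ax : a < x by apply: lt_x; rewrite mem_cat al.
  (* If [b < a], then [a], [x.+1], [b], [x] would form 2413. *)
  have := av a x.+1 b x; rewrite lt_ax ltnSn !andbT.
  have -> : subseq [:: a; x.+1; b; x] (l ++ x.+1 :: rcons r1 x).
    apply: (@cat_subseq _ [:: a]); rewrite ?sub1seq //= eqxx -cats1.
    by apply: (@cat_subseq _ [:: b]); rewrite ?sub1seq ?inE.
  by move=> /(_ isT)/andP[]; lia.
move: Dw; rewrite dumont_glue1 // => /andP[Dl Dr].
have [||k [r' [le_kn wl wr Er]]] := dumont_split lt_lr Elr Dl _ Dr _.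
- exact: avoids_subseq Aw.
- by apply: avoids_subseq Aw; apply: subseq_trans sub_r; apply: subseq_rcons.
by exists k, (l, r'); split=> //; left; split; last rewrite /glue1 Er.
Qed.

(** * Enumeration by gluing, without repetition *)

Definition word_pairs n k : seq (seq nat * seq nat) :=
  [seq (l, r) | l <- dumont_words k, r <- dumont_words (n - k)].

Lemma dumont_words_uniq n : uniq (dumont_words n).
Proof. by rewrite filter_uniq // permutations_uniq. Qed.

Lemma word_pairs_uniq n k : uniq (word_pairs n k).
Proof.
apply: allpairs_uniq; try exact: dumont_words_uniq.
by move=> [? ?] [? ?] _ _ [-> ->].
Qed.

Lemma mem_word_pairs n k u :
  (u \in word_pairs n k) = (u.1 \in dumont_words k) && (u.2 \in dumont_words (n - k)).
Proof.
case: u => l r; apply/allpairsP/andP => [[[l' r'] /= [wl wr [-> ->]]] //|[wl wr]].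
by exists (l, r).
Qed.

Lemma dumont_words_bound k w :
  w \in dumont_words k -> forall y, y \in w -> y <= 2 * k.
Proof.
by rewrite mem_dumont_words => /and3P[_ _ /mem_iota_perm in_w] y; rewrite in_w; lia.
Qed.

Lemma dumont_words_size k w : w \in dumont_words k -> size w = 2 * k.
Proof. by rewrite mem_dumont_words => /and3P[_ _ /perm_size]; rewrite size_iota. Qed.

(** Cutting at the maximum, which is absent from the left word, recovers that word; its length gives
    [k], and undoing the shift gives the right word. *)
Lemma glue1_uniq n : uniq [seq glue1 n k u | k <- iota 0 n.+1, u <- word_pairs n k].
Proof.
apply: allpairs_uniq_dep => [|k _|]; [exact: iota_uniq | |]; first exact: word_pairs_uniq.
move=> _ _ /allpairsPdep[k [[l r] [ks + ->]]] /allpairsPdep[k' [[l' r'] [ks' + ->]]] /=.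
rewrite !mem_word_pairs /= => /andP[wl _] /andP[wl' _] /eqP.
move: ks ks'; rewrite !mem_iota => le_kn le_k'n.
rewrite /glue1 eqseq_pivot2l; last 2 first.
- by apply/negP=> /(dumont_words_bound wl); lia.
- by apply/negP=> /(dumont_words_bound wl'); lia.
case/andP=> /eqP /= El; have := dumont_words_size wl; rewrite El.
rewrite (dumont_words_size wl') => /(congr1 half); rewrite !mul2n !doubleK => Ek.
by rewrite -Ek eqseq_rcons eqxx andbT => /eqP/(inj_map (@addnI _)) ->.
Qed.

Lemma glue2_uniq n : uniq [seq glue2 n k u | k <- iota 0 n, u <- word_pairs n k].
Proof.
apply: allpairs_uniq_dep => [|k _|]; [exact: iota_uniq | |]; first exact: word_pairs_uniq.
move=> _ _ /allpairsPdep[k [[l r] [ks + ->]]] /allpairsPdep[k' [[l' r'] [ks' + ->]]] /=.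
rewrite !mem_word_pairs /= => /andP[wl _] /andP[wl' _] /eqP.
move: ks ks'; rewrite !mem_iota => le_kn le_k'n.
rewrite /glue2 eqseq_pivot2l; last 2 first.
- by rewrite mem_rcons inE; apply/negP=> /orP[|/(dumont_words_bound wl)]; lia.
- by rewrite mem_rcons inE; apply/negP=> /orP[|/(dumont_words_bound wl')]; lia.
rewrite eqseq_rcons eqxx andbT.
case/andP=> /eqP /= El; have := dumont_words_size wl; rewrite El.
rewrite (dumont_words_size wl') => /(congr1 half); rewrite !mul2n !doubleK => Ek.
by rewrite -Ek => /eqP/(inj_map (@addnI _)) ->.
Qed.

Lemma perm_dumont_words n :
  perm_eq (dumont_words n.+1)
    ([seq glue1 n k u | k <- iota 0 n.+1, u <- word_pairs n k] ++
     [seq glue2 n k u | k <- iota 0 n, u <- word_pairs n k]).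
Proof.
apply: uniq_perm; first exact: dumont_words_uniq.
  rewrite cat_uniq glue1_uniq glue2_uniq andbT.
  apply/hasPn=> _ /allpairsPdep[k [[l r] [kn + ->]]]; rewrite mem_word_pairs => /andP[wl _].
  apply/negP=> /allpairsPdep[k' [[l' r'] [kn' + /eqP]]]; rewrite mem_word_pairs => /andP[wl' _].
  rewrite !mem_iota in kn kn'; rewrite /glue1 /glue2 eqseq_pivot2l; last 2 first.
  - by rewrite mem_rcons inE; apply/negP=> /orP[|/(dumont_words_bound wl)]; lia.
  - by apply/negP=> /(dumont_words_bound wl'); lia.
  (* A word of both forms, cut at its maximum, would have [2n+1] in the left word [l'] of [glue1],
     whose letters are at most [2 * k']. *)
  case/andP=> /eqP /= El _; have := dumont_words_bound wl' (y := (2 * n).+1).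
  by rewrite /= -El mem_rcons mem_head => /(_ isT); lia.
move=> w; rewrite mem_cat; apply/idP/orP.
  move/dumont_unglue=> [k [u [wl wr]]] [][lt_kn ->]; [left|right].
    by apply/allpairsPdep; exists k, u; rewrite mem_iota mem_word_pairs wl wr; split=> //; lia.
  by apply: allpairs_f_dep; rewrite ?mem_iota ?mem_word_pairs ?wl ?wr //; lia.
case=> /allpairsPdep[k [[l r] [+ + ->]]]; rewrite mem_iota mem_word_pairs => kn /andP[wl wr].
  by apply: glue1_dumont => //; lia.
by apply: glue2_dumont => //; lia.
Qed.

(** * The recurrence of the counts and of the little Schröder numbers *)

(** Each gluing map contributes one sum; the second omits [k = n], where the right word would be
    empty. *)
Lemma size_dumont_words_rec n :
  size (dumont_words n.+1) =
    \sum_(0 <= k < n.+1) size (dumont_words k) * size (dumont_words (n - k)) +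
    \sum_(0 <= k < n) size (dumont_words k) * size (dumont_words (n - k)).
Proof.
rewrite (perm_size (perm_dumont_words n)) size_cat !size_allpairs_dep !sumnE !big_map.
by rewrite /index_iota !subn0; congr addn; apply: eq_bigr => k _; rewrite size_allpairs.
Qed.

Lemma size_dumont_words0 : size (dumont_words 0) = 1.
Proof.
have av0 : avoids [::] by apply/avoids_allP.
by move: av0; rewrite /dumont_words /= => ->.
Qed.

Lemma size_schroder_list m : size (schroder_list m) = m.+1.
Proof. by elim: m => //= m IHm; rewrite size_rcons IHm. Qed.

(** Each list extends the previous one, so an entry does not depend on the stage at which it is
    read. *)
Lemma nth_schroder_list m j :
  j <= m -> (nth 0%R (schroder_list m) j) = little_schroder j.
Proof.
elim: m => [|m IHm]; first by case: j.
rewrite leq_eqVlt ltnS => /predU1P[->//|le_jm].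
by rewrite /= nth_rcons size_schroder_list ltnS le_jm IHm.
Qed.

Lemma little_schroder_rec n :
  little_schroder n.+2 =
    (2 * (\sum_(0 <= k < n.+1) little_schroder k.+1 * little_schroder (n - k).+1)
     - little_schroder n.+1)%R.
Proof.
rewrite {1}/little_schroder /schroder_list -/(schroder_list n.+1) nth_rcons.
(* The term for [m = 1] vanishes at [m = n+2], and the sum is reindexed by [j = k+1]. *)
rewrite size_schroder_list ltnn eqxx nth_schroder_list // GRing.addr0 big_add1 succnK.
congr (2 * _ - _)%R; apply: eq_big_nat => k /andP[_ lt_kn].
have -> : n.+2 - k.+1 = (n - k).+1 by lia.
by rewrite !nth_schroder_list //; lia.
Qed.

Lemma size_dumont_words n : (size (dumont_words n))%:Z%R = little_schroder n.+1.
Proof.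
have [m] := ubnP n; elim: m n => // m IHm [|n]; rewrite ltnS => lt_nm.
  by rewrite size_dumont_words0 /little_schroder /= big_geq.
rewrite little_schroder_rec size_dumont_words_rec.
pose d k := size (dumont_words k); pose S := \sum_(0 <= k < n.+1) d k * d (n - k).
(* The second sum lacks only the last term [d n * d 0 = d n], so both sums together give
   [2S - d n]. *)
have S_rec : S = \sum_(0 <= k < n) d k * d (n - k) + d n.
  by rewrite /S big_nat_recr //= subnn [d 0]size_dumont_words0 muln1.
have <- : S%:Z%R =
    (\sum_(0 <= k < n.+1) little_schroder k.+1 * little_schroder (n - k).+1)%R.
  rewrite /S (big_morph Posz PoszD (erefl _)); apply: eq_big_nat => k /andP[_ lt_kn].
  rewrite PoszM !IHm //; first exact: leq_ltn_trans (leq_subr _ _) lt_nm.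
  exact: leq_trans lt_kn lt_nm.
rewrite -IHm // -/d -[\sum_(0 <= k < n.+1) _]/S -/(d n).
by move: S_rec; move: S (d n) (\sum_(0 <= k < n) _) => s a b; clear; lia.
Qed.

(** * Passage between permutations and words *)

Lemma word_inj m : injective (@word m).
Proof.
move=> p q /eq_in_map Epq; apply/permP=> i; apply: val_inj.
by apply: succn_inj; apply: Epq; rewrite mem_enum.
Qed.

Lemma perm_word m (p : {perm 'I_m}) : perm_eq (word p) (iota 1 m).
Proof.
apply: uniq_perm; rewrite ?iota_uniq //.
  by rewrite map_inj_uniq ?enum_uniq // => i j /succn_inj/val_inj/perm_inj.
move=> x; rewrite mem_iota; apply/mapP/idP => [[i _ ->]|x_in].
  by rewrite /= add1n ltnS ltn_ord.
have lt_x : x.-1 < m by lia.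
exists (p^-1%g (Ordinal lt_x)); rewrite ?mem_enum // permKV /=; lia.
Qed.

(** The predecessors of the letters define a self-map of ['I_m]; it is injective as [w] has no
    repeated letter, hence a permutation. *)
Lemma word_onto m w : perm_eq w (iota 1 m) -> exists p : {perm 'I_m}, word p = w.
Proof.
move=> Ew; have sz_w : size w = m by rewrite (perm_size Ew) size_iota.
have w_in (i : 'I_m) : 1 <= nth 0 w i < 1 + m.
  by rewrite -(mem_iota_perm Ew) mem_nth // sz_w.
have lt_w (i : 'I_m) : (nth 0 w i).-1 < m by have := w_in i; lia.
have f_inj : injective (fun i => Ordinal (lt_w i)).
  move=> i j /(congr1 val) /= Eij; apply/val_inj/eqP.
  rewrite -(nth_uniq 0 (s := w)) ?sz_w ?ltn_ord ?(perm_uniq Ew) ?iota_uniq //.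
  move: Eij (w_in i) (w_in j); move: (nth 0 w i) (nth 0 w j) => a b; clear; lia.
exists (perm f_inj); apply: (@eq_from_nth _ 0); first by rewrite size_map size_enum_ord.
move=> i; rewrite size_map size_enum_ord => lt_im.
rewrite (nth_map (Ordinal lt_im)) ?size_enum_ord // permE /= nth_enum_ord //.
by have := w_in (Ordinal lt_im); rewrite /=; lia.
Qed.

Theorem theorem3p5 (n : nat) :
  (#|Dumont1_avoiding n [:: pat2341; pat2413]|%:Z)%R
  = little_schroder n.+1.
Proof.
(* As [word] is injective, it suffices that the words of the counted permutations are exactly the
   members of [dumont_words n]. *)
rewrite -size_dumont_words cardE -(size_map (@word _)).
congr (_%:Z)%R; apply/perm_size/uniq_perm; last 1 first.
- move=> w; rewrite mem_dumont_words; apply/mapP/and3P => [[p + ->]|[Dw Aw Ew]].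
    rewrite mem_enum inE /dumont1 dumont1_wordE => /andP[-> ->]; split=> //.
    exact: perm_word.
  have [p Ep] := word_onto Ew; exists p => //.
  by rewrite mem_enum inE /dumont1 dumont1_wordE Ep Dw Aw.
- by rewrite (map_inj_uniq (@word_inj _)) enum_uniq.
exact: dumont_words_uniq.
Qed.
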